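(* For all $\tau\in\{0,1\}^{\mathbb N}$, the subshift $(Y_\tau,S)$ is minimal if and only if $\tau$ contains infinitely many $0$s.
   Context: Conventions: $\mathbb N=\{0,1,2,\dots\}$; $S$ is the shift, $(Sx)_n=x_{n+1}$. A subshift is a nonempty closed subset $Z$ of $\Sigma^{\mathbb Z}$ ($\Sigma$ finite) with $S(Z)=Z$; it is minimal if it contains no proper subshift. Smooth sequences. A mono-symbol block of $x\in\{1,3\}^{\mathbb Z}$ is a maximal run of equal consecutive symbols. If all mono-symbol blocks of $x$ are finite, $\Delta x$ is the bi-infinite sequence of lengths of the consecutive mono-symbol blocks of $x$, indexed so that $(\Delta x)_0$ is the length of the block containing position $0$. $x$ is smooth if $\Delta^k x$ is well-defined and in $\{1,3\}^{\mathbb Z}$ for all $k\ge0$. $X$ is the set of bi-infinite smooth sequences. Recoding. Let $\mathcal A=\{\mathtt A,\mathtt B,\mathtt C,\mathtt D\}$ encode the blocks $\mathtt A=1$, $\mathtt B=3$, $\mathtt C=111$, $\mathtt D=333$. For $x\in X$, $\mathrm{rec}(x)\in\mathcal A^{\mathbb Z}$ is the sequence of codes of the consecutive mono-symbol blocks of $x$, with $\mathrm{rec}(x)_0$ the code of the block containing $x_0$. Each letter of $y=\mathrm{rec}(x)$ corresponds to one letter of $\Delta x$. The factor of $y$ corresponding to a mono-symbol block of $\Delta x$ is called an elementary block of $y$: the block $1$ gives $\mathtt A$ or $\mathtt B$; $3$ gives $\mathtt C$ or $\mathtt D$; $111$ gives $\mathtt{ABA}$ or $\mathtt{BAB}$;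 $333$ gives $\mathtt{CDC}$ or $\mathtt{DCD}$. Types. $x\in X$ has type $0$ if $\mathrm{rec}(x)$ contains an elementary block in $\{\mathtt{ABA},\mathtt{DCD}\}$, and type $1$ if it contains an elementary block in $\{\mathtt{BAB},\mathtt{CDC}\}$; every $x\in X$ has exactly one type. $\mathrm{Types}(x)=(\mathrm{type}(\Delta^n x))_{n\in\mathbb N}$, $X_\tau=\{x\in X:\mathrm{Types}(x)=\tau\}$ and $Y_\tau=\mathrm{rec}(X_\tau)\subset\mathcal A^{\mathbb Z}$. *)

(* Defs.v *)
From HB Require Import structures.
From mathcomp Require Import all_boot all_order all_algebra.
From mathcomp Require Import all_classical all_reals all_analysis.
Set Implicit Arguments.
Unset Strict Implicit.
Unset Printing Implicit Defensive.
Import Order.TTheory GRing.Theory Num.Theory.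
Local Open Scope classical_set_scope.
Local Open Scope ring_scope.

Definition shift (T : Type) (x : int -> T) : int -> T := fun n => x (n + 1).

(* Product topology of the discrete topologies on the alphabet. *)
Definition fullshift (Sigma : choiceType) : topologicalType :=
  {ptws int -> discrete_topology Sigma}.

Definition subshift (Sigma : finType) (Z : set (fullshift Sigma)) : Prop :=
  [/\ Z !=set0, closed Z & @shift Sigma @` Z = Z].

Definition minimal_subshift (Sigma : finType) (Z : set (fullshift Sigma)) :
    Prop :=
  subshift Z /\ ~ (exists2 W : set (fullshift Sigma), subshift W & W `<` Z).

(* Smooth sequences have values in {1, 3}; they are represented as sequences of
   natural numbers so that a sequence of block lengths is always of this type. *)

Definition finite_blocks (x : int -> nat) : Prop :=
  forall n : int,
    (exists2 m : int, m < n & x m <> x n) /\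
    (exists2 m : int, n < m & x m <> x n).

(* [b i] is the first position of the [i]-th mono-symbol block of [x], the block
   number 0 being the one that contains position 0. Such a [b] is unique, and it
   exists exactly when all mono-symbol blocks of [x] are finite. *)
Definition enum_blocks (x : int -> nat) (b : int -> int) : Prop :=
  [/\ b 0 <= 0 < b 1,
      forall i, b i < b (i + 1),
      forall i n, b i <= n < b (i + 1) -> x n = x (b i) &
      forall i, x (b (i + 1)) <> x (b i)].

(* The value is meaningful only under [finite_blocks x]. *)
Definition block_start (x : int -> nat) : int -> int :=
  xget (fun i : int => i) [set b : int -> int | enum_blocks x b].

Definition Delta (x : int -> nat) : int -> nat :=
  fun i => `|block_start x (i + 1) - block_start x i|%N.

Definition smooth (x : int -> nat) : Prop :=
  forall k : nat, finite_blocks (iter k Delta x) /\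
    (forall n, iter k Delta x n = 1%N \/ iter k Delta x n = 3%N).

(* LA, LB, LC, LD encode the blocks 1, 3, 111, 333. *)
Inductive letter := LA | LB | LC | LD.

Definition letter_code (a : letter) : 'I_4 :=
  match a with
  | LA => inord 0 | LB => inord 1 | LC => inord 2 | LD => inord 3
  end.

Definition letter_decode (i : 'I_4) : letter := nth LA [:: LA; LB; LC; LD] i.

Lemma letter_codeK : cancel letter_code letter_decode.
Proof. by case; rewrite /letter_decode inordK. Qed.

HB.instance Definition _ := Finite.copy letter (can_type letter_codeK).

(* Code of the block made of [l] copies of the symbol [s], for s, l in {1, 3}. *)
Definition block_letter (s l : nat) : letter :=
  if l == 1%N then (if s == 1%N then LA else LB)
  else (if s == 1%N then LC else LD).

Definition rec (x : int -> nat) : int -> letter :=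
  fun i => block_letter (x (block_start x i)) (Delta x i).

(* The factor of [rec x] at the positions of the [j]-th block of [Delta x]. *)
Definition elementary_block (x : int -> nat) (j : int) : seq letter :=
  [seq rec x (block_start (Delta x) j + k%:Z) |
    k <- iota 0 (Delta (Delta x) j)].

Definition has_type (x : int -> nat) (t : 'I_2) : Prop :=
  exists j : int, elementary_block x j \in
    (if t == ord0 then [:: [:: LA; LB; LA]; [:: LD; LC; LD]]
     else [:: [:: LB; LA; LB]; [:: LC; LD; LC]]).

(* A smooth sequence has exactly one type, so the second clause says that the
   sequence of types of the iterates of [Delta] on [x] is [tau]. *)
Definition Xtau (tau : nat -> 'I_2) : set (int -> nat) :=
  [set x | smooth x /\ forall n : nat, has_type (iter n Delta x) (tau n)].

Definition Ytau (tau : nat -> 'I_2) : set (fullshift letter) :=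
  rec @` Xtau tau.

(* Main.v *)
(* Since all blocks have odd length, consecutive elementary blocks of [rec x]
   begin with different symbols; hence [rec x] is, up to translation, the image
   of [rec (Delta x)] under one substitution, chosen by the type of [x]. The
   cutting points are the changes of letter length, so that this
   desubstitution is unique and local, and Y_tau consists of the sequences that
   can be desubstituted forever. Closedness follows from locality, and
   nonemptiness from compactness.

   If type 0 occurs infinitely often, every letter occurs in every element of
   Y_tau. A factor of length l + 1 lies in the image of l consecutive letters
   preceded by one letter, and that one is determined by the next letter. By
   induction on l all elements of Y_tau have the same factors. If all types from
   N on are 1, then the letter D arises only from D at these levels, and the
   sequences whose N-th desubstitution avoids D form a proper subshift. *)

Require Import Defs.
From mathcomp Require Import all_boot all_order all_algebra.
From mathcomp Require Import all_classical all_reals all_analysis.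
From mathcomp Require Import zify.
Local Open Scope classical_set_scope.
Set Implicit Arguments.
Unset Strict Implicit.
Unset Printing Implicit Defensive.
Import Order.TTheory GRing.Theory Num.Theory.
Local Open Scope ring_scope.

(** * Limits in the full shift *)

Definition agree T (N : nat) (x y : int -> T) : Prop :=
  forall i : int, (`|i| <= N)%N -> x i = y i.

(** Closedness in the product topology, expressed by finite windows around the origin. *)
Definition limit_closed T (Z : set (int -> T)) : Prop :=
  forall y, (forall N, exists2 w, Z w & agree N w y) -> Z y.

Section Topology.
Variable S : finType.
Implicit Types (Z : set (fullshift S)) (x y : int -> S).

Lemma nbhs_coordinate y i : nbhs (y : fullshift S) [set w | w i = y i].
Proof.
have /(_ [set y i]) := @proj_continuous int (fun=> discrete_topology S) i y.
by apply; exact: (@discrete_set1 (discrete_topology S)).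
Qed.

Lemma nbhs_agree y N : nbhs (y : fullshift S) [set w | agree N w y].
Proof.
elim: N => [|N IH].
  by apply: filterS (nbhs_coordinate y 0) => w w0 i i0; have -> : i = 0 by lia.
have hp := nbhs_coordinate y N.+1%:Z; have hn := nbhs_coordinate y (- N.+1%:Z).
apply: filterS (filterI IH (filterI hp hn)) => w [wN [wp wn]] i iN.
have [/wN //|iN'] := leqP `|i| N.
by have [->|->] : i = N.+1%:Z \/ i = - N.+1%:Z by lia.
Qed.

Lemma agree_cvg (u : nat -> fullshift S) y :
  (forall N, agree N (u N) y) -> u @ \oo --> (y : fullshift S).
Proof.
move=> uy; apply/cvg_sup => i U [V] [[W] oW <-] Wy WU.
apply: filterS WU _; exists `|i|%N => // n /= iN.
by rewrite /= uy.
Qed.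

Lemma closedP Z : closed Z <-> limit_closed Z.
Proof.
split=> [cZ y hy|cZ y hy]; last first.
  apply: cZ => N; have [w [Zw wy]] := hy _ (nbhs_agree y N).
  by exists w.
have /choice[u uP] : forall N, exists w, Z w /\ agree N w y.
  by move=> N; have [w] := hy N; exists w.
apply: (closed_cvg _ cZ) (agree_cvg (u := u) _) => [|N]; last by case: (uP N).
by apply: nearW => N; case: (uP N).
Qed.

(** Cantor intersection: by Tychonoff, points chosen in the [C n] cluster somewhere, and closedness
    puts the cluster point in every [C n]. *)
Lemma nested_nonempty (C : nat -> set (int -> S)) :
  (forall n, limit_closed (C n)) -> (forall n, C n.+1 `<=` C n) ->
  (forall n, C n !=set0) -> \bigcap_n C n !=set0.
Proof.
move=> clC decC neC.
have monoC m n : (m <= n)%N -> C n `<=` C m.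
  move=> /subnK <-; elim: (n - m)%N => // k IH.
  exact: subset_trans (decC _) IH.
have [u uC] := choice neC.
have cT := @tychonoff int (fun=> discrete_topology S) (fun=> setT)
  (fun=> @finite_compact (discrete_topology S) _ (@finite_finset S setT)).
have [|p [_ clp]] := cT ((u : nat -> fullshift S) @ \oo) _; first by exists 0%N.
exists p => n _.
have /closedP : limit_closed (C n) := clC n.
apply => U Up.
by apply: clp Up; exists n => // m /= nm; apply: monoC nm _ (uC m).
Qed.

End Topology.

(** * Enumerations of blocks *)

(** Produces block starts from prescribed block lengths. As [Negz k] is -(k+1), the negative branch
    subtracts the lengths at -1, -2, and so on. *)
Lemma cumulative_sum (l : int -> nat) :
  exists b : int -> int, b 0 = 0 /\ forall i : int, b (i + 1) = b i + (l i)%:Z.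
Proof.
exists (fun i => match i with
  | Posz n => \sum_(k < n) (l k)%:Z
  | Negz n => - \sum_(k < n.+1) (l (Negz k))%:Z end).
split=> [|[n|[|n]]]; first by rewrite /= big_ord0.
- have -> : n%:Z + 1 = n.+1%:Z by lia.
  by rewrite big_ord_recr.
- have -> : Negz 0 + 1 = 0%N :> int by lia.
  by rewrite big_ord0 big_ord_recr big_ord0 /=; lia.
have -> : Negz n.+1 + 1 = Negz n by lia.
rewrite [in RHS]big_ord_recr /=. by rewrite opprD addrNK.
Qed.

Lemma int_ind2 (P : int -> Prop) (a : int) :
  P a -> (forall n : int, a <= n -> P n -> P (n + 1)) ->
  (forall n : int, n <= a -> P n -> P (n - 1)) -> forall n, P n.
Proof.
move=> Pa Pp Pn n; have [an|/ltW na] := leP a n.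
  have -> : n = a + `|n - a|%N by lia.
  elim: `|_|%N => [|k IH]; first by rewrite addr0.
  have -> : a + k.+1%:Z = a + k%:Z + 1 by lia.
  by apply: Pp IH; lia.
have -> : n = a - `|n - a|%N%:Z by lia.
elim: `|_|%N => [|k IH]; first by rewrite subr0.
have -> : a - k.+1%:Z = a - k%:Z - 1 by lia.
by apply: Pn IH; lia.
Qed.

Definition increasing (b : int -> int) : Prop := forall i : int, b i < b (i + 1).

Section Increasing.
Variables (b : int -> int) (incb : increasing b).

Lemma increasing_shift (i : int) (k : nat) : b i + k%:Z <= b (i + k%:Z).
Proof.
elim: k => [|k IH]; first by rewrite !addr0.
have -> : i + k.+1%:Z = i + k%:Z + 1 by lia.
by have := incb (i + k%:Z); lia.
Qed.

Lemma increasing_mono (i j : int) : i <= j -> b i + (j - i) <= b j.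
Proof.
move=> ij; have := increasing_shift i `|j - i|%N.
have -> : i + `|j - i|%N%:Z = j by lia.
lia.
Qed.

Lemma block_of (n : int) : exists i : int, b i <= n < b (i + 1).
Proof.
move: n; apply: (@int_ind2 _ (b 0)) => [|n _ [i bi]|n _ [i bi]].
- by exists 0; rewrite lexx incb.
- have [ni|ni] := ltP (n + 1) (b (i + 1)); first by exists i; lia.
  by exists (i + 1); have := incb (i + 1); lia.
- have [ni|ni] := leP (b i) (n - 1); first by exists i; lia.
  exists (i - 1); have := incb (i - 1).
  have -> : i - 1 + 1 = i by lia.
  lia.
Qed.

Lemma block_of_unique (n i j : int) :
  b i <= n < b (i + 1) -> b j <= n < b (j + 1) -> i = j.
Proof.
move=> ni nj; have [ij|ij|//] := ltgtP i j.
  by have := @increasing_mono (i + 1) j; lia.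
by have := @increasing_mono (j + 1) i; lia.
Qed.

(** Defines a sequence block by block: each position has exactly one block and offset. *)
Lemma glue T (f : int -> nat -> T) :
  exists y : int -> T, forall (i : int) (k : nat),
    b i + k%:Z < b (i + 1) -> y (b i + k%:Z) = f i k.
Proof.
have [c cP] := choice block_of.
exists (fun n => f (c n) `|n - b (c n)|%N) => i k ik.
have -> : c (b i + k%:Z) = i by apply: (block_of_unique (cP _)); lia.
congr f; lia.
Qed.

End Increasing.

Definition boundary (x : int -> nat) (n : int) : Prop := x n <> x (n - 1).

Lemma enum_blocksE (x : int -> nat) (b : int -> int) :
  enum_blocks x b <->
  [/\ b 0 <= 0 < b 1, increasing b,
      forall i n : int, b i <= n < b (i + 1) -> x n = x (b i) &
      forall i : int, x (b (i + 1)) <> x (b i)].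
Proof. by []. Qed.

Lemma enum_blocks_increasing x b : enum_blocks x b -> increasing b.
Proof. by case. Qed.

Lemma enum_blocks_boundary x b (i : int) : enum_blocks x b -> boundary x (b i).
Proof.
move=> /enum_blocksE[_ incb cst chg]; have := chg (i - 1); have := incb (i - 1).
rewrite /boundary (subrK 1 i) => lt.
by rewrite (cst (i - 1) (b i - 1)) // (subrK 1 i); lia.
Qed.

Lemma enum_blocks_inside x b (i n : int) :
  enum_blocks x b -> b i < n < b (i + 1) -> ~ boundary x n.
Proof.
move=> /enum_blocksE[_ incb cst chg] ni;
  apply; rewrite !(cst i) //; lia. Qed.

Lemma enum_blocksP (x : int -> nat) (b : int -> int) :
  [/\ b 0 <= 0 < b 1, increasing b, forall i : int, boundary x (b i) &
      forall i n : int, b i < n < b (i + 1) -> ~ boundary x n] -> enum_blocks x b.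
Proof.
case=> b0 incb bd nbd.
have cst (i n : int) : b i <= n < b (i + 1) -> x n = x (b i).
  move: n; apply: (@int_ind2 _ (b i)) => [//|n bn IH nb|n bn _ nb]; last by lia.
  by have /contrapT := nbd i (n + 1) ltac:(lia); rewrite addrK => ->; apply: IH; lia.
apply/enum_blocksE; split=> // i; have := bd (i + 1).
rewrite /boundary (cst i (b (i + 1) - 1)) //.
by have := incb i; lia.
Qed.

(** The boundaries of both sequences agree on the window, which starts at [b m - 1] because a
    boundary test looks one position to the left. The starts are then matched from block 0
    outwards. *)
Lemma enum_blocks_local x x' b b' (m n : int) :
  enum_blocks x b -> enum_blocks x' b' -> m <= 0 -> 0 < n ->
  (forall j : int, b m - 1 <= j <= b n -> x j = x' j) ->
  forall i : int, m <= i <= n -> b i = b' i.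
Proof.
move=> ex ex' m0 n0 xx' i.
have incb := enum_blocks_increasing ex; have incb' := enum_blocks_increasing ex'.
have /enum_blocksE[b0 _ _ _] := ex; have /enum_blocksE[b'0 _ _ _] := ex'.
have bnd (j : int) : b m <= j <= b n -> boundary x j <-> boundary x' j.
  by move=> jmn; rewrite /boundary !xx' //; lia.
have bd (j : int) : m <= j <= n -> boundary x' (b j).
  move=> jmn; apply/bnd; last exact: enum_blocks_boundary ex.
  by have := @increasing_mono _ incb m j; have := @increasing_mono _ incb j n; lia.
have nbd (j k : int) : m <= j < n -> b j < k < b (j + 1) -> ~ boundary x' k.
  move=> jmn kj /bnd bk; apply: (enum_blocks_inside ex kj); apply: bk.
  have := @increasing_mono _ incb m j.
  by have := @increasing_mono _ incb (j + 1) n; lia.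
have bd' (j : int) : boundary x' (b' j) := enum_blocks_boundary ex'.
have nbd' (j k : int) : b' j < k < b' (j + 1) -> ~ boundary x' k.
  exact: enum_blocks_inside ex'.
(* If these starts differed, the larger one would be a boundary strictly inside the other sequence's
   block around 0. *)
have base : b 0 = b' 0.
  have [b1 b'1] : b ((0 : int) + 1) = b 1 /\ b' ((0 : int) + 1) = b' 1 by [].
  have [lt|lt|//] := ltgtP (b 0) (b' 0).
    by case: (@nbd 0 (b' 0) _ _ (bd' 0)); lia.
  by case: (@nbd' 0 (b 0) _ (bd 0 _)); lia.
have next (j : int) : m <= j < n -> b j = b' j -> b (j + 1) = b' (j + 1).
  move=> jmn bj; have := incb j; have := incb' j.
  have [lt|lt|//] := ltgtP (b (j + 1)) (b' (j + 1)) => *.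
    by case: (@nbd' j (b (j + 1)) _ (bd (j + 1) _)); lia.
  by case: (@nbd j (b' (j + 1)) jmn _ (bd' (j + 1))); lia.
have prev (j : int) : m <= j < n -> b (j + 1) = b' (j + 1) -> b j = b' j.
  move=> jmn bj; have := incb j; have := incb' j.
  have [lt|lt|//] := ltgtP (b j) (b' j) => *.
    by case: (@nbd j (b' j) jmn _ (bd' j)); lia.
  by case: (@nbd' j (b j) _ (bd j _)); lia.
move: i; apply: (@int_ind2 _ 0) => [//|i i0 IH ?|i i0 IH ?].
  by apply: next; [lia|apply: IH; lia].
by apply: prev; rewrite ?subrK; [lia|apply: IH; lia].
Qed.

Lemma enum_blocks_unique x b b' : enum_blocks x b -> enum_blocks x b' -> b = b'.
Proof.
move=> ex ex'; apply/funext => i.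
by apply: (@enum_blocks_local x x b b' (- `|i|%N%:Z) (`|i|%N%:Z + 1)) => //; lia.
Qed.

Lemma block_start_eq x b : enum_blocks x b -> block_start x = b.
Proof.
move=> ex; apply: (@enum_blocks_unique x) => //.
by rewrite /block_start; case: xgetP => [c -> //|/(_ b)].
Qed.

(** Start at the last position satisfying [P] at or before 0, then iterate the next such position
    ([s]) and the previous one ([q]). *)
Lemma enumerate (P : int -> Prop) :
  (forall n : int, exists2 m : int, n < m & P m) ->
  (forall n : int, exists2 m : int, m <= n & P m) ->
  exists b : int -> int, [/\ b 0 <= 0 < b 1, increasing b, forall i : int, P (b i) &
    forall i n : int, b i < n < b (i + 1) -> ~ P n].
Proof.
move=> Pup Pdown.
have /choice[s sP] (n : int) :
    exists m : int, [/\ n < m, P m & forall k : int, n < k < m -> ~ P k].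
  have ex : exists k : nat, `[< P (n + k.+1%:Z) >].
    have [m nm Pm] := Pup n; exists (absz (m - n - 1)%R); apply/asboolP.
    by have -> : n + (absz (m - n - 1)%R).+1%:Z = m by lia.
  case: (ex_minnP ex) => k /asboolP Pk mink.
  exists (n + k.+1%:Z); split=> //; first lia.
  move=> j jn Pj; have : (k <= absz (j - n - 1)%R)%N; last by lia.
  by apply: mink; apply/asboolP; have -> : n + (absz (j - n - 1)%R).+1%:Z = j by lia.
have /choice[p pP] (n : int) :
    exists m : int, [/\ m <= n, P m & forall k : int, m < k <= n -> ~ P k].
  have ex : exists k : nat, `[< P (n - k%:Z) >].
    have [m nm Pm] := Pdown n; exists (absz (n - m)%R); apply/asboolP.
    by have -> : n - (absz (n - m)%R)%:Z = m by lia.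
  case: (ex_minnP ex) => k /asboolP Pk mink; exists (n - k%:Z); split=> //; first lia.
  move=> j jn Pj; have : (k <= absz (n - j)%R)%N; last by lia.
  by apply: mink; apply/asboolP; have -> : n - (absz (n - j)%R)%:Z = j by lia.
pose q (n : int) : int := p (n - 1).
have qP (n : int) : [/\ q n < n, P (q n) & forall k : int, q n < k < n -> ~ P k].
  have [? ? gap] := pP (n - 1); split=> // [|k kn]; first by rewrite /q; lia.
  by apply: gap; move: kn; rewrite /q; lia.
pose b (i : int) : int := match i with
  | Posz k => iter k s (p 0)
  | Negz k => iter k.+1 q (p 0) end.
have bP (i : int) : P (b i).
  case: i => [[|k]|k] /=; first by case: (pP 0).
    by case: (sP (iter k s (p 0))).
  by case: (qP (iter k q (p 0))).
have step (i : int) : b i < b (i + 1) /\ forall n : int, b i < n < b (i + 1) -> ~ P n.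
  case: i => k.
    have -> : Posz k + 1 = Posz k.+1 by lia.
    by have [? ? ?] := sP (iter k s (p 0)).
  have -> : Negz k + 1 = - k%:Z by lia.
  have -> : b (- k%:Z) = iter k q (p 0) by case: k.
  by have [? ? ?] := qP (iter k q (p 0)).
exists b; split=> // [|i|i]; [|by case: (step i)..].
(* The start of block 1 is positive, since [p 0] is already the last [P] position up to 0. *)
have /= [? ? gap] := pP 0; have /= [? ? ?] := sP (p 0).
rewrite /b /=; apply/andP; split=> //; rewrite ltNge; apply/negP => s0.
by apply: (gap (s (p 0))) => //; lia.
Qed.

Lemma enum_blocks_exists x : finite_blocks x -> exists b, enum_blocks x b.
Proof.
move=> fx; have diff (m n : int) : m <= n -> x m <> x n ->
    exists2 k : int, m < k <= n & boundary x k.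
  move=> mn; apply: contra_notP => nk; move: n mn nk.
  apply: (@int_ind2 _ m) => // [n mn IH _ nk|n ? _ ?]; last by lia.
  have /contrapT xn1 : ~ boundary x (n + 1).
    by move=> bn; apply: nk; exists (n + 1) => //; lia.
  rewrite xn1 addrK; apply: IH => // -[k kn bk]; apply: nk; exists k => //; lia.
have [n|n|b ebP] := @enumerate (boundary x).
- have [_ [m nm /nesym xmn]] := fx n; have [|k kP bk] := diff n m _ xmn; first lia.
  by exists k => //; lia.
- have [[m nm xmn] _] := fx n; have [|k kP bk] := diff m n _ xmn; first lia.
  by exists k => //; lia.
by exists b; apply/enum_blocksP.
Qed.

Lemma enum_blocks_finite x b : enum_blocks x b -> finite_blocks x.
Proof.
move=> ex n; have /enum_blocksE[_ incb cst chg] := ex.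
have [i ni] := block_of incb n; rewrite (cst i n) //; split.
  exists (b i - 1); first by lia.
  by have : boundary x (b i) := enum_blocks_boundary ex; rewrite /boundary => /nesym.
by exists (b (i + 1)) => //; lia.
Qed.

(** * Desubstitution *)

(** Together with [len3] this codes a letter by two bits, so that both substitutions become one
    exclusive-or formula. *)
Definition sym3 (a : letter) : bool := if a is (LB | LD) then true else false.
Definition len3 (a : letter) : bool := if a is (LC | LD) then true else false.

Definition mk_letter (s l : bool) : letter :=
  if l then (if s then LD else LC) else (if s then LB else LA).

Definition one_or_three (c : bool) : nat := if c then 3%N else 1%N.
Definition sym a := one_or_three (sym3 a).
Definition len a := one_or_three (len3 a).

Definition lens (y : int -> letter) : int -> nat := fun i => len (y i).

Definition alternate (y : int -> letter) : Prop :=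
  forall i : int, sym3 (y (i + 1)) = ~~ sym3 (y i).

(* The [k]-th letter of the image of [a] under the substitution
   A -> A, B -> D, C -> ABA, D -> DCD of type 0 ([t = false]), resp.
   A -> B, B -> C, C -> BAB, D -> CDC of type 1 ([t = true]); the image has
   length [len a]. *)
Definition subst_letter (t : bool) (a : letter) (k : nat) : letter :=
  mk_letter (sym3 a (+) t (+) odd k) (sym3 a).

(** The condition on [b 0] and [b 1] puts position 0 in the image of [z 0]; this makes [z] unique,
    not merely unique up to translation. *)
Definition desubst (t : bool) (y : int -> letter) (b : int -> int)
    (z : int -> letter) : Prop :=
  [/\ b 0 <= 0 < b 1, alternate z,
      forall i : int, b (i + 1) = b i + (len (z i))%:Z &
      forall (i : int) (k : nat), (k < len (z i))%N ->
        y (b i + k%:Z) = subst_letter t (z i) k].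

Lemma sym3_mk s l : sym3 (mk_letter s l) = s. Proof. by case: s; case: l. Qed.
Lemma len3_mk s l : len3 (mk_letter s l) = l. Proof. by case: s; case: l. Qed.
Lemma mk_letterK a : mk_letter (sym3 a) (len3 a) = a. Proof. by case: a. Qed.

Lemma len_gt0 a : (0 < len a)%N. Proof. by case: a. Qed.
Lemma len_le3 a : (len a <= 3)%N. Proof. by case: a. Qed.
Lemma odd_len a : odd (len a). Proof. by case: a. Qed.

Lemma one_or_three_inj : injective one_or_three. Proof. by do 2!case. Qed.

Lemma block_letterK a : block_letter (sym a) (len a) = a.
Proof. by case: a. Qed.

Lemma block_letter_one_or_three s l :
  block_letter (one_or_three s) (one_or_three l) = mk_letter s l.
Proof. by case: s; case: l. Qed.

Lemma alternate_sub1 y : alternate y ->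
  forall i : int, sym3 (y (i - 1)) = ~~ sym3 (y i).
Proof. by move=> alt i; rewrite -{2}(subrK 1 i) alt negbK. Qed.

Section Desubst.
Variables (t : bool) (y z : int -> letter) (b : int -> int).
Hypothesis hd : desubst t y b z.

Lemma desubst_increasing : increasing b.
Proof. by case: hd => _ _ hb _ i; rewrite hb; have := len_gt0 (z i); lia. Qed.

Lemma desubst_at (n : int) : exists i k, [/\ (k < len (z i))%N, n = b i + k%:Z &
    y n = subst_letter t (z i) k].
Proof.
have [_ _ hb hy] := hd; have [i ni] := block_of desubst_increasing n.
have [k ki nE] : exists2 k, (k < len (z i))%N & n = b i + k%:Z.
  by exists (absz (n - b i)%R); have := hb i; lia.
by exists i, k; split=> //; rewrite nE hy.
Qed.

Lemma desubst_len3 (i : int) (k : nat) : (k < len (z i))%N ->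
  len3 (y (b i + k%:Z)) = sym3 (z i).
Proof. by case: hd => _ _ _ hy ki; rewrite hy // len3_mk. Qed.

Lemma desubst_sym3 (i : int) (k : nat) : (k < len (z i))%N ->
  sym3 (y (b i + k%:Z)) = sym3 (z i) (+) t (+) odd k.
Proof. by case: hd => _ _ _ hy ki; rewrite hy // sym3_mk. Qed.

Lemma desubst_start (i : int) : y (b i) = subst_letter t (z i) 0.
Proof. by case: hd => _ _ _ hy; rewrite -hy ?len_gt0 // addr0. Qed.

(** All letters in the image of [z i] have length bit [sym3 (z i)], which flips at each cutting
    point because [z] alternates. *)
Lemma desubst_enum : enum_blocks (lens y) b.
Proof.
have [b0 alt hb hy] := hd; apply/enum_blocksE; split=> //.
- exact: desubst_increasing.
- move=> i n ni; have nE : n = b i + (absz (n - b i)%R)%:Z by lia.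
  have ki : (absz (n - b i)%R < len (z i))%N by have := hb i; lia.
  by rewrite nE /lens /len desubst_len3 // desubst_start len3_mk.
- move=> i; rewrite /lens /len !desubst_start !len3_mk alt.
  by move=> /one_or_three_inj; case: sym3.
Qed.

(** Recognizability: [z] is recovered from the letter lengths of [y] alone, without reference to
    [t]. *)
Lemma desubst_rec : rec (lens y) = z.
Proof.
apply/funext => i; have [_ _ hb _] := hd.
rewrite /rec /Delta (block_start_eq desubst_enum) hb.
have -> : (absz (b i + (len (z i))%:Z - b i)%R) = len (z i) by lia.
by rewrite /lens /len desubst_start len3_mk block_letterK.
Qed.

Lemma desubst_alternate : alternate y.
Proof.
have [_ alt hb hy] := hd.
move=> n; have [i [k [ki -> _]]] := desubst_at n.
rewrite desubst_sym3 //; have [ki'|ki'] := ltnP k.+1 (len (z i)).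
  have -> : b i + k%:Z + 1 = b i + k.+1%:Z by lia.
  by rewrite desubst_sym3 //= addbN.
(* The last offset is even, images being of odd length, so an image ends with the symbol it starts
   with, and the next image starts with the other one. *)
have -> : b i + k%:Z + 1 = b (i + 1) by rewrite hb; lia.
rewrite desubst_start sym3_mk alt; have -> : k = (len (z i)).-1 by lia.
by case: (z i); case: (t).
Qed.

End Desubst.

Lemma desubst_unique t t' y z z' b b' :
  desubst t y b z -> desubst t' y b' z' -> b = b' /\ z = z'.
Proof.
move=> h h'; split; last by rewrite -(desubst_rec h) (desubst_rec h').
exact: enum_blocks_unique (desubst_enum h) (desubst_enum h').
Qed.

Lemma desubst_exists t z : alternate z -> exists b y, desubst t y b z.
Proof.
move=> alt; have [b [b0 hb]] := cumulative_sum (lens z).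
have incb : increasing b by move=> i; rewrite hb /lens; have := len_gt0 (z i); lia.
have [y hy] := glue incb (fun i k => subst_letter t (z i) k).
exists b, y; split => // [|i k ki]; last by rewrite hy // hb /lens; lia.
by have := incb 0; have -> : b ((0 : int) + 1) = b 1 by []; lia.
Qed.

Definition translate T (c : int) (x : int -> T) : int -> T := fun n => x (n + c).

Lemma desubst_translate t y b z c : desubst t y b z ->
  exists b' d, desubst t (translate c y) b' (translate d z).
Proof.
move=> h; have [_ alt hb hy] := h.
have [d dc] := block_of (desubst_increasing h) c.
exists (fun i => b (i + d) - c), d; split.
- have b0 : b (0 + d) = b d by congr b; lia.
  have b1 : b (1 + d) = b (d + 1) by congr b; lia.
  by rewrite b0 b1; lia.
- by move=> i; rewrite /translate -alt; congr (sym3 (z _)); lia.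
- move=> i; have -> : b (i + 1 + d) = b (i + d + 1) by congr b; lia.
  by rewrite hb /translate; lia.
- by move=> i k ki; rewrite /translate -hy //; congr y; lia.
Qed.

Lemma desubst_nonconstant t y b z (n : int) : desubst t y b z ->
  (exists2 m : int, n - 3 <= m < n & lens y m <> lens y n) /\
  (exists2 m : int, n < m <= n + 3 & lens y m <> lens y n).
Proof.
move=> h; have := desubst_enum h => /[dup] e /enum_blocksE[_ incb cst chg].
have [_ _ hb _] := h; have [i ni] := block_of incb n.
have := hb i; have := len_le3 (z i) => ? ?; rewrite (cst _ _ ni); split.
  exists (b i - 1); first by lia.
  have : boundary (lens y) (b i) := enum_blocks_boundary e.
  by rewrite /boundary => /nesym.
by exists (b (i + 1)) => //; lia.
Qed.

(* Since blocks have length at most 3, a window of [y] determines a window of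
   its desubstitution. *)
Lemma desubst_limit t (Q : set (int -> letter)) : limit_closed Q ->
  limit_closed [set y | exists b z, desubst t y b z /\ Q z].
Proof.
move=> clQ y hy.
have fin : finite_blocks (lens y).
  (* Radius 3 around [n] suffices to see a change of length on each side, and this passes from [w]
     to [y]. *)
  move=> n; have [w [b [z [h _]]] wy] := hy (`|n| + 3)%N.
  have e (m : int) : n - 3 <= m <= n + 3 -> lens y m = lens w m.
    by move=> mn; rewrite /lens wy //; lia.
  have [[m mn dm] [m' mn' dm']] := desubst_nonconstant n h.
  by split; [exists m|exists m']; rewrite ?e //; lia.
have [b ey] := enum_blocks_exists fin; have incb := enum_blocks_increasing ey.
(* The only possible choice: a desubstitution is the recoding of the length sequence. *)
pose z (i : int) := block_letter (lens y (b i)) (absz (b (i + 1) - b i)%R).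
have window K : exists w bw zw, [/\ desubst t w bw zw, Q zw,
    agree K zw z, forall i : int, (`|i| <= K.+1)%N -> bw i = b i &
    forall (i : int) n, (`|i| <= K)%N -> b i <= n < b (i + 1) -> w n = y n].
  (* One index beyond [K], because block [K] ends at the start of block [K + 1]. *)
  pose m : int := - K.+1%:Z; pose n : int := K.+1%:Z.
  have [w [bw [zw [h Qz]]] wy] := hy (`|b m| + `|b n| + 1)%N.
  have mono i j := @increasing_mono _ incb i j.
  have wy' (j : int) : b m - 1 <= j <= b n -> w j = y j.
    by move=> jmn; apply: wy; lia.
  have bE (i : int) : (`|i| <= K.+1)%N -> bw i = b i.
    move=> iK; apply/esym.
    apply: (enum_blocks_local ey (desubst_enum h) (m := m) (n := n)); try lia.
    by move=> j jmn; rewrite /lens wy'.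
  have wy'' (i j : int) : (`|i| <= K)%N -> b i <= j < b (i + 1) -> w j = y j.
    by move=> iK ij; apply: wy'; have := mono m i; have := mono (i + 1) n; lia.
  exists w, bw, zw; split=> // i iK.
  rewrite -(desubst_rec h) /rec /Delta (block_start_eq (desubst_enum h)) !bE; try lia.
  by rewrite /lens (wy'' i) //; have := incb i; lia.
exists b, z; split; last first.
  by apply: clQ => N; have [w [bw [zw [_ Qz zwz _ _]]]] := window N; exists zw.
split.
- by case/enum_blocksE: ey.
- move=> i; have [w [bw [zw [[_ alt _ _] _ zwz _ _]]]] := window (`|i| + 1)%N.
  by rewrite -!zwz ?alt //; lia.
- move=> i; have [w [bw [zw [[_ _ hb _] _ zwz bE _]]]] := window `|i|%N.
  by rewrite -zwz // -!bE ?hb //; lia.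
- move=> i k ki; have [w [bw [zw [[_ _ hb hw] _ zwz bE wy]]]] := window `|i|%N.
  have e : b (i + 1) = b i + len (zw i) by rewrite -!bE ?hb //; lia.
  rewrite -zwz // in ki *; rewrite -hw // bE; last lia.
  by rewrite (wy i) //; lia.
Qed.

(** * Infinitely desubstitutable sequences *)

Definition tail (tau : nat -> bool) (m : nat) : nat -> bool := fun k => tau (k + m)%N.

Fixpoint lifted (tau : nat -> bool) (n : nat) (Q : set (int -> letter)) :
    set (int -> letter) :=
  if n is n'.+1 then
    [set y | exists b z, desubst (tau 0%N) y b z /\ lifted (tail tau 1) n' Q z]
  else Q.

(** A decreasing intersection of finite-depth conditions, suited to compactness; uniqueness of
    desubstitution links the depths into a single chain. *)
Definition Y (tau : nat -> bool) : set (int -> letter) :=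
  [set y | forall n, lifted tau n alternate y].

Lemma tail_tail tau m n : tail (tail tau m) n = tail tau (n + m).
Proof. by apply/funext => k; rewrite /tail addnA. Qed.

Lemma lifted_sub tau n (Q Q' : set (int -> letter)) :
  Q `<=` Q' -> lifted tau n Q `<=` lifted tau n Q'.
Proof.
move=> QQ'; elim: n tau => [//|n IH] tau y [b [z [h /IH ?]]].
by exists b, z.
Qed.

Lemma lifted_add tau m n Q :
  lifted tau (m + n) Q = lifted tau m (lifted (tail tau m) n Q).
Proof.
elim: m tau => [|m IH] tau /=.
  by congr lifted; apply/funext => k; rewrite /tail addn0.
by rewrite IH tail_tail addn1.
Qed.

(** By uniqueness, the desubstitutions obtained for different [k] are the same sequence. *)
Lemma lifted_bigcap tau n (Q : nat -> set (int -> letter)) y :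
  (forall k, lifted tau n (Q k) y) -> lifted tau n [set z | forall k, Q k z] y.
Proof.
elim: n tau y => [//|n IH] tau y hy.
have [b [z [h _]]] := hy 0%N; exists b, z; split => //; apply: IH => k.
by have [b' [z' [h' Qz']]] := hy k; have [_ ->] := desubst_unique h h'.
Qed.

Lemma liftedI tau n Q Q' y :
  lifted tau n Q y -> lifted tau n Q' y -> lifted tau n (Q `&` Q') y.
Proof.
move=> yQ yQ'; pose P k : set (int -> letter) := if k is 0%N then Q else Q'.
apply: (@lifted_sub tau n [set z | forall k, P k z]).
  by move=> z Pz; split; [exact: (Pz 0%N)|exact: (Pz 1%N)].
by apply: lifted_bigcap; case.
Qed.

Lemma lifted_alternate tau n y : lifted tau n alternate y -> alternate y.
Proof. by case: n => [//|n] [b [z [h _]]]; apply: desubst_alternate h. Qed.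

Lemma lifted_decreasing tau n :
  lifted tau n.+1 alternate `<=` lifted tau n alternate.
Proof.
rewrite -addn1 lifted_add; apply: lifted_sub => y.
exact: (@lifted_alternate _ 1).
Qed.

Lemma Y_lifted tau n : Y tau = lifted tau n (Y (tail tau n)).
Proof.
apply/seteqP; split=> y.
  by move=> hy; apply: lifted_bigcap => k; rewrite -lifted_add.
(* Depth [k] above level [n] gives depth [n + k]; the surplus is dropped by monotonicity. *)
move=> hy k; suff : lifted tau (n + k) alternate y.
  elim: n {hy} => [//|n IH]; rewrite addSn => /lifted_decreasing.
  exact: IH.
by rewrite lifted_add; apply: lifted_sub hy => z; apply.
Qed.

Lemma Y_desubst tau y :
  Y tau y -> exists b z, desubst (tau 0%N) y b z /\ Y (tail tau 1) z.
Proof. by rewrite (Y_lifted tau 1). Qed.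

Lemma lifted_limit_closed tau n Q : limit_closed Q -> limit_closed (lifted tau n Q).
Proof. by move=> clQ; elim: n tau => [//|n IH] tau; apply: desubst_limit. Qed.

Lemma lifted_nonempty tau n Q : Q `<=` alternate ->
  Q !=set0 -> lifted tau n Q !=set0.
Proof.
(* Alternation is carried along because [desubst_exists] substitutes into alternating sequences. *)
move=> altQ neQ; suff [y [_ ?]] : exists y, alternate y /\ lifted tau n Q y by exists y.
elim: n tau => [|n IH] tau; first by have [y /[dup] /altQ] := neQ; exists y.
have [z [alt zQ]] := IH (tail tau 1); have [b [y h]] := desubst_exists (tau 0%N) alt.
by exists y; split; [apply: desubst_alternate h|exists b, z].
Qed.

Lemma alternate_limit_closed : limit_closed alternate.
Proof.
move=> y hy i; have [w alt wy] := hy (`|i| + 1)%N.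
by rewrite -!wy ?alt //; lia.
Qed.

Lemma Y_limit_closed tau : limit_closed (Y tau).
Proof.
move=> y hy n; apply: (lifted_limit_closed (@alternate_limit_closed)) => N.
by have [w Yw wy] := hy N; exists w.
Qed.

(** Compactness passes from every finite depth to infinite depth; [F] allows a closed condition,
    such as the absence of a letter, to be kept in the limit. *)
Lemma Y_nonempty tau (F : set (int -> letter)) : limit_closed F ->
  (forall n, F `&` lifted tau n alternate !=set0) -> F `&` Y tau !=set0.
Proof.
move=> clF neF.
have [|n|n|y hy] := @nested_nonempty letter (fun n => F `&` lifted tau n alternate).
- move=> n y hy; split; first by apply: clF => N; have [w [? _] ?] := hy N; exists w.
  apply: (lifted_limit_closed (@alternate_limit_closed)) => N.
  by have [w [_ ?] ?] := hy N; exists w.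
- by apply: setIS; apply: lifted_decreasing.
- exact: neF.
exists y; split; first by have [] := hy 0%N I.
by move=> n; have [] := hy n I.
Qed.

(** * Translation invariance and the subshift property *)

Definition translation_invariant (Q : set (int -> letter)) : Prop :=
  forall c y, Q y -> Q (translate c y).

Lemma lifted_translate tau n Q :
  translation_invariant Q -> translation_invariant (lifted tau n Q).
Proof.
move=> trQ; elim: n tau => [//|n IH] tau c y [b [z [h hz]]].
have [b' [d h']] := desubst_translate c h.
by exists b', (translate d z); split=> //; apply: IH.
Qed.

Lemma alternate_translate : translation_invariant alternate.
Proof. by move=> c y alt i; rewrite /translate -alt; congr (sym3 (y _)); lia. Qed.

Lemma Y_translate tau : translation_invariant (Y tau).
Proof. by move=> c y hy n; apply: (lifted_translate alternate_translate). Qed.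

Lemma subshiftP (Z : set (fullshift letter)) :
  Z !=set0 -> limit_closed Z -> translation_invariant Z -> subshift Z.
Proof.
move=> neZ /closedP clZ trZ; split=> //; apply/seteqP; split=> [_ [y Zy <-]|y Zy].
  exact: trZ Zy.
exists (translate (-1) y); first exact: trZ.
by apply/funext => n; rewrite /Defs.shift /translate; congr y; lia.
Qed.

Lemma subshift_translate (Z : set (fullshift letter)) :
  subshift Z -> translation_invariant Z.
Proof.
case=> _ _ sZ.
have shiftZ y : Z y -> Z (translate 1 y) by move=> Zy; rewrite -sZ; exists y.
have unshiftZ y : Z y -> Z (translate (-1) y).
  rewrite -{1}sZ => -[w Zw <-]; suff -> : translate (-1) (Defs.shift w) = w by [].
  by apply/funext => n; rewrite /Defs.shift /translate; congr w; lia.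
have trD m n (y : int -> letter) : translate m (translate n y) = translate (m + n) y.
  by apply/funext => k; rewrite /translate addrA.
apply: (@int_ind2 _ 0) => [y|c _ IH y /IH/shiftZ|c _ IH y /IH/unshiftZ].
- by congr Z; apply/funext => n; rewrite /translate addr0.
- by rewrite trD addrC.
- by rewrite trD addrC.
Qed.

Definition alternating_AB (n : int) : letter := if odd `|n|%N then LB else LA.

Lemma alternating_AB_alternate : alternate alternating_AB.
Proof.
move=> i; rewrite /alternating_AB.
have -> : odd (absz (i + 1)%R) = ~~ odd `|i|%N by lia.
by case: odd.
Qed.

Lemma Y_subshift tau : subshift (Y tau : set (fullshift letter)).
Proof.
apply: subshiftP; [|exact: Y_limit_closed|exact: Y_translate].
have [//|n|y [_ Yy]] := @Y_nonempty tau setT; last by exists y.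
have [//||y hy] := @lifted_nonempty tau n alternate; last by exists y.
by exists alternating_AB; exact: alternating_AB_alternate.
Qed.

(** * Recodings of smooth sequences *)

(** One level of smoothness: since [lens] only takes the values 1 and 3, the last equation restricts
    the block lengths to these. *)
Definition recodable (x : int -> nat) : Prop :=
  [/\ finite_blocks x, forall n : int, exists c, x n = one_or_three c &
      Delta x = lens (rec x)].

Lemma one_or_threeP (n : nat) : n = 1%N \/ n = 3%N <-> exists c, n = one_or_three c.
Proof. by split=> [[->|->]|[[|] ->]]; [exists false|exists true|right|left]. Qed.

Lemma block_startP x : finite_blocks x -> enum_blocks x (block_start x).
Proof. by move=> /enum_blocks_exists[b ex]; rewrite (block_start_eq ex). Qed.

Lemma smooth_recodable x k : smooth x -> recodable (iter k Delta x).
Proof.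
move=> sx; have [fx vx] := sx k; have [_ vx1] := sx k.+1; split=> //.
  by move=> n; apply/one_or_threeP.
apply/funext => i; have /one_or_threeP[c vc] := vx (block_start (iter k Delta x) i).
have /one_or_threeP[d vd] := vx1 i; rewrite /= in vd.
by rewrite /lens /rec vc vd block_letter_one_or_three /len len3_mk.
Qed.

Section Recodable.
Variable x : int -> nat.
Hypothesis rx : recodable x.

Lemma recodable_enum : enum_blocks x (block_start x).
Proof. by case: rx => fx _ _; apply: block_startP. Qed.

Lemma recodable_sym (i : int) : sym (rec x i) = x (block_start x i).
Proof.
have [_ vx dx] := rx; rewrite /rec dx; have [c ->] := vx (block_start x i).
by rewrite /lens /len block_letter_one_or_three /sym sym3_mk.
Qed.

Lemma recodable_alternate : alternate (rec x).
Proof.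
move=> i; have /enum_blocksE[_ _ _ chg] := recodable_enum.
have := chg i; rewrite -!recodable_sym /sym.
by case: sym3; case: sym3.
Qed.

End Recodable.

Lemma alternate_shift y (i : int) (k : nat) :
  alternate y -> sym3 (y (i + k%:Z)) = sym3 (y i) (+) odd k.
Proof.
move=> alt; elim: k => [|k IH]; first by rewrite addr0 addbF.
have -> : i + k.+1%:Z = i + k%:Z + 1 by lia.
by rewrite alt IH /= addbN.
Qed.

(** The elementary block witnessing the type fixes the starting symbol at one index [j]; odd lengths
    propagate this in both directions. *)
Lemma recodable_desubst x (t : 'I_2) :
  recodable x -> recodable (Delta x) -> has_type x t ->
  desubst (t != ord0) (rec x) (block_start (Delta x)) (rec (Delta x)).
Proof.
move=> rx rx1 [j jt]; set y := rec x; set b := block_start _; set z := rec _.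
have alty : alternate y := recodable_alternate rx.
have altz : alternate z := recodable_alternate rx1.
have /enum_blocksE[b0 incb cst chg] : enum_blocks (Delta x) b := recodable_enum rx1.
have hb (i : int) : b (i + 1) = b i + (len (z i))%:Z.
  have [_ _ /(congr1 (fun f => f i))] := rx1; rewrite /Delta /lens -/z -/b => <-.
  by have := incb i; lia.
have dy : Delta x = lens y by case: rx.
have len3y (i : int) (k : nat) :
    (k < len (z i))%N -> len3 (y (b i + k%:Z)) = sym3 (z i).
  move=> ki; apply: one_or_three_inj; rewrite -/(sym (z i)) recodable_sym // -/b.
  by rewrite -(cst i (b i + k%:Z)) ?dy //; have := hb i; lia.
have start (i : int) : sym3 (y (b i)) = sym3 (z i) (+) (t != ord0).
  have step (k : int) : sym3 (y (b (k + 1))) = ~~ sym3 (y (b k)).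
    by rewrite hb alternate_shift // odd_len addbT.
  move: i; apply: (@int_ind2 _ j) => [|i _ IH|i _ IH]; last first.
  - have := step (i - 1); rewrite subrK IH alternate_sub1 // addNb => ->.
    by rewrite negbK.
  - by rewrite step IH altz addNb.
  (* At [j] the first letter decides: its symbol and length are equal in ABA and DCD, different in
     BAB and CDC. *)
  have := len3y j 0%N (len_gt0 _); rewrite addr0 => <-.
  move: jt; rewrite /elementary_block -/b -/y; have [_ _ ->] := rx1.
  rewrite /lens -/z; case: (len (z j)) => [|n] /=; first by case: eqP.
  rewrite addr0; case: eqP => _; rewrite !inE => /orP[] /eqP[-> _] //=.
by split=> // i k ki; rewrite -(mk_letterK (y _)) len3y // alternate_shift // start.
Qed.

Lemma desubst_recodable x t b z : recodable x -> desubst t (rec x) b z ->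
  recodable (Delta x) /\ rec (Delta x) = z.
Proof.
move=> [fx vx dx] h; have e := desubst_enum h.
have rz : rec (Delta x) = z by rewrite dx (desubst_rec h).
split=> //; split; first by rewrite dx; apply: enum_blocks_finite e.
  by move=> n; rewrite dx; exists (len3 (rec x n)).
rewrite rz; apply/funext => i; rewrite dx /Delta (block_start_eq e) /lens.
by have [_ _ hb _] := h; rewrite hb; lia.
Qed.

(** The image of a letter of length 3 is one of the two elementary blocks that witness type [t]. *)
Lemma desubst_has_type x (t : 'I_2) b z (j : int) :
  recodable x -> desubst (t != ord0) (rec x) b z -> len3 (z j) -> has_type x t.
Proof.
move=> rx h zj; have [rx1 rz] := desubst_recodable rx h.
exists j; rewrite /elementary_block; have [_ _ ->] := rx1.
rewrite rz /lens; have [_ _ ->] := rx; rewrite (block_start_eq (desubst_enum h)).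
have [_ _ _ hy] := h; move: (hy j); case: (z j) zj => //= _ {}hy;
  by rewrite !hy //; case: eqP => _; rewrite !inE eqxx ?orbT.
Qed.

Lemma desubst_has_len3 t y b z : desubst t y b z -> exists j, len3 (y j).
Proof.
move=> h; have [_ [m _]] := desubst_nonconstant 0 h; rewrite /lens /len.
by case E: (len3 (y m)); [exists m|case E0: (len3 (y 0)); [exists 0|]].
Qed.

(** Each letter is expanded into its run of symbols; alternation makes these runs maximal. *)
Lemma decode y : alternate y -> exists2 x, recodable x & rec x = y.
Proof.
move=> alt; have [b [b0 hb]] := cumulative_sum (lens y).
have incb : increasing b by move=> i; rewrite hb /lens; have := len_gt0 (y i); lia.
have [x hx] := glue incb (fun i _ => sym (y i)).
have hx' (i n : int) : b i <= n < b (i + 1) -> x n = sym (y i).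
  move=> ni; have nE : n = b i + (absz (n - b i)%R)%:Z by lia.
  by rewrite nE hx //; lia.
have start (i : int) : x (b i) = sym (y i) by apply: hx'; have := incb i; lia.
have e : enum_blocks x b.
  apply/enum_blocksE; split=> //.
  - by have := incb 0; have -> : b ((0 : int) + 1) = b 1 by []; lia.
  - by move=> i n ni; rewrite start; apply: hx'.
  - by move=> i; rewrite !start /sym alt => /one_or_three_inj; case: sym3.
have dx : Delta x = lens y.
  by apply/funext => i; rewrite /Delta (block_start_eq e) hb; lia.
have rx : rec x = y.
  by apply/funext => i; rewrite /rec dx (block_start_eq e) start block_letterK.
exists x => //; split; [exact: enum_blocks_finite e| |by rewrite rx].
by move=> n; have [i /hx'] := block_of incb n; exists (sym3 (y i)).
Qed.

Definition nonzero_type (tau : nat -> 'I_2) : nat -> bool := fun n => tau n != ord0.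

(** Replaces smoothness by substitutions: levels of [Delta] and levels of desubstitution correspond
    one to one. *)
Lemma Ytau_eq tau : Ytau tau = (Y (nonzero_type tau) : set (fullshift letter)).
Proof.
apply/seteqP; split=> [_ [x [sx tx] <-] n|y Yy].
  suff H k : lifted (tail (nonzero_type tau) k) n alternate (rec (iter k Delta x)).
    have := H 0%N; congr lifted; apply/funext => k; congr nonzero_type.
    by rewrite addn0.
  elim: n k => [|n IH] k; first by apply: recodable_alternate; apply: smooth_recodable.
  exists (block_start (iter k.+1 Delta x)), (rec (iter k.+1 Delta x)).
  rewrite tail_tail add1n; split => //; apply: recodable_desubst => //.
  - exact: smooth_recodable.
  - exact: (@smooth_recodable _ k.+1).
have [x rx xy] := decode (Yy 0%N).
have H k : recodable (iter k Delta x) /\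
    Y (tail (nonzero_type tau) k) (rec (iter k Delta x)).
  elim: k => [|k [IH /Y_desubst[b [z [h Yz]]]]].
    rewrite /= xy; split=> // n; move: (Yy n); congr lifted.
    by apply/funext => k; rewrite /tail addn0.
  have [? rz] := desubst_recodable IH h.
  by rewrite /= rz; split=> //; rewrite -[k.+1]add1n -tail_tail.
exists x => //; split=> k.
  have [fx vx dx] := (H k).1; split=> //.
  by move=> n; apply/one_or_threeP.
(* Since [z] can itself be desubstituted, it has a letter of length 3, whose image shows the
   type. *)
have [rk /Y_desubst[b [z [h /Y_desubst[b' [z' [h' _]]]]]]] := H k.
have [j zj] := desubst_has_len3 h'.
exact: (desubst_has_type rk h zj).
Qed.

(** * Minimality *)

Definition infinitely_many_type0 (tau : nat -> bool) : Prop :=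
  forall m, exists2 n, (m <= n)%N & ~~ tau n.

Lemma infinitely_many_tail tau m :
  infinitely_many_type0 tau -> infinitely_many_type0 (tail tau m).
Proof.
move=> inf k; have [n kn tn] := inf (k + m)%N; exists (n - m)%N; first by lia.
by rewrite /tail subnK //; lia.
Qed.

Lemma alternate_sym3 y c : alternate y -> exists i, sym3 (y i) = c.
Proof.
move=> alt; have := alt 0; case E : (sym3 (y 0)) => /= E1.
  by case: c; [exists 0|exists (0 + 1)].
by case: c; [exists (0 + 1)|exists 0].
Qed.

Lemma desubst_occurs t y b z (i : int) (k : nat) :
  desubst t y b z -> (k < len (z i))%N -> exists j, y j = subst_letter t (z i) k.
Proof. by case=> _ _ _ hy ki; exists (b i + k%:Z); apply: hy. Qed.

Section Letters.
Variables (tau : nat -> bool) (y : int -> letter).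
Hypothesis Yy : Y tau y.

(* The first letter of a substituted letter depends only on its symbol. *)
Lemma edge_letter_occurs s : exists j, y j = mk_letter (s (+) tau 0%N) s.
Proof.
have [b [z [h _]]] := Y_desubst Yy; have [_ alt _ _] := h.
have [i <-] := alternate_sym3 s alt.
have [j yj] := desubst_occurs h (len_gt0 (z i)).
by exists j; rewrite yj /subst_letter addbF.
Qed.

(** Supplies the letters that never start an image: B and C for type 0, A and D for type 1. *)
Lemma middle_letter_occurs b z a i : desubst (tau 0%N) y b z ->
  z i = a -> len3 a -> exists j, y j = subst_letter (tau 0%N) a 1.
Proof. by move=> h <- zi3; apply: desubst_occurs h _; case: (z i) zi3. Qed.

End Letters.

(** At a level of type 0, D starts the image of any letter with symbol 3; levels of type 1 pass it
    down through D -> CDC. The induction is on the index of a level of type 0. *)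
Lemma LD_occurs tau y : infinitely_many_type0 tau -> Y tau y -> exists j, y j = LD.
Proof.
move=> /(_ 0%N)[n _]; elim: n tau y => [|n IH] tau y tn Yy.
  by have := edge_letter_occurs Yy true; rewrite (negbTE tn).
have [b [z [h Yz]]] := Y_desubst Yy.
have [|i zi] := IH (tail tau 1) z _ Yz; first by rewrite /tail addn1.
case E : (tau 0%N); last by have := edge_letter_occurs Yy true; rewrite E.
by have := middle_letter_occurs h zi isT; rewrite E.
Qed.

(** C starts an image for type 1; for type 0 it is the middle of DCD, the image of a D one level
    up. *)
Lemma LC_occurs tau y : infinitely_many_type0 tau -> Y tau y -> exists j, y j = LC.
Proof.
move=> inf Yy; have [b [z [h Yz]]] := Y_desubst Yy.
case E : (tau 0%N); first by have := edge_letter_occurs Yy true; rewrite E.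
have [i zi] := LD_occurs (infinitely_many_tail 1 inf) Yz.
by have := middle_letter_occurs h zi isT; rewrite E.
Qed.

Lemma letter_occurs tau y a :
  infinitely_many_type0 tau -> Y tau y -> exists j, y j = a.
Proof.
move=> inf Yy; have [b [z [h Yz]]] := Y_desubst Yy.
(* The image of C is ABA or BAB and so contains both A and B. *)
have [i zi] := LC_occurs (infinitely_many_tail 1 inf) Yz.
case: a; [| |exact: LC_occurs inf Yy|exact: LD_occurs inf Yy].
  case E : (tau 0%N); last by have := edge_letter_occurs Yy false; rewrite E.
  by have := middle_letter_occurs h zi isT; rewrite E.
case E : (tau 0%N); first by have := edge_letter_occurs Yy false; rewrite E.
by have := middle_letter_occurs h zi isT; rewrite E.
Qed.

(** * Common factors and minimality *)

Definition same_factor (l : nat) (y : int -> letter) (i : int)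
    (w : int -> letter) (j : int) : Prop :=
  forall k : nat, (k < l)%N -> y (i + k%:Z) = w (j + k%:Z).

Lemma desubst_before t y b z (i : int) : desubst t y b z ->
  y (b i - 1) = mk_letter (~~ sym3 (y (b i))) (~~ len3 (y (b i))).
Proof.
move=> h; rewrite -(mk_letterK (y (b i - 1))); congr mk_letter.
  exact: alternate_sub1 (desubst_alternate h) _.
have := enum_blocks_boundary (i := i) (desubst_enum h).
by rewrite /boundary /lens /len; case: len3; case: len3.
Qed.

(* The extra letter on the left is determined because both symbol and length
   change at a cutting point. *)
Lemma same_factor_desubst t y b z w b' z' (p q : int) (l : nat) :
  desubst t y b z -> desubst t w b' z' -> (0 < l)%N -> same_factor l z p z' q ->
  forall n : int, b p - 1 <= n < b (p + l%:Z) -> y n = w (n - b p + b' q).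
Proof.
move=> h h' l0 zz' n np.
have [_ _ hb hy] := h; have [_ _ hb' hy'] := h'.
(* Equal letters have images of equal length, so the cutting points stay parallel. *)
have starts k : (k <= l)%N -> b (p + k%:Z) - b p = b' (q + k%:Z) - b' q.
  elim: k => [|k IH] kl; first by rewrite !addr0 !subrr.
  have [-> ->] : p + k.+1%:Z = p + k%:Z + 1 /\ q + k.+1%:Z = q + k%:Z + 1 by lia.
  by rewrite hb hb' zz' //; have := IH (ltnW kl); lia.
have [lt|ge] := ltP n (b p).
  have zpq : z p = z' q by have := zz' 0%N l0; rewrite !addr0.
  have [-> ->] : n = b p - 1 /\ b p - 1 - b p + b' q = b' q - 1 by lia.
  rewrite (desubst_before _ h) (desubst_before _ h').
  by rewrite !(desubst_start h) !(desubst_start h') zpq.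
have incb := desubst_increasing h; have [r nr] := block_of incb n.
have pr : p <= r.
  by rewrite leNgt; apply/negP => rp; have := @increasing_mono _ incb (r + 1) p; lia.
have rl : r < p + l%:Z.
  by rewrite ltNge; apply/negP => lr; have := @increasing_mono _ incb (p + l%:Z) r; lia.
have [k kl rE] : exists2 k, (k < l)%N & r = p + k%:Z by exists (absz (r - p)%R); lia.
have [m nE] : exists m : nat, n = b r + m%:Z by exists (absz (n - b r)%R); lia.
have ml : (m < len (z r))%N by have := hb r; lia.
have e := starts k (ltnW kl).
have -> : n - b p + b' q = b' (q + k%:Z) + m%:Z by rewrite nE rE; lia.
by rewrite nE hy // rE hy' -zz' // -rE.
Qed.

Lemma factor_occurs l tau y w (i : int) : infinitely_many_type0 tau ->
  Y tau y -> Y tau w -> exists j, same_factor l.+1 y i w j.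
Proof.
elim: l tau y w i => [|l IH] tau y w i inf Yy Yw.
  have [j wj] := letter_occurs (y i) inf Yw; exists j => -[|//] _.
  by rewrite !addr0.
have [b [z [h Yz]]] := Y_desubst Yy; have [b' [z' [h' Yz']]] := Y_desubst Yw.
(* Locating [i + 1] leaves position [i] to the extra letter on the left, so [l + 1] letters of [z]
   determine [l + 2] letters of [y]. *)
have incb := desubst_increasing h; have [p ip] := block_of incb (i + 1).
have [q zz'] := IH _ z z' p (infinitely_many_tail 1 inf) Yz Yz'.
exists (i - b p + b' q) => k kl.
have := same_factor_desubst h h' (ltn0Sn l) zz'; move=> /(_ (i + k%:Z)) ->.
  by congr w; lia.
have := @increasing_mono _ incb (p + 1) (p + l.+1%:Z); lia.
Qed.

Lemma Y_minimal tau : infinitely_many_type0 tau ->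
  minimal_subshift (Y tau : set (fullshift letter)).
Proof.
move=> inf; split; first exact: Y_subshift.
case=> W sW [WY nYW]; apply: nYW => y Yy.
have [[w Ww] /closedP clW _] := sW; apply: clW => N.
(* The window from [-N] to [N] of [y] occurs in [w] at [j]; translating by [j + N] centres it. *)
have [j wj] := factor_occurs (N + N) (- N%:Z) inf Yy (WY w Ww).
exists (translate (j + N%:Z) w); first exact: (subshift_translate sW).
move=> i iN; have := wj (absz (i + N%:Z)%R) => wji.
have [e1 e2] : - N%:Z + (absz (i + N%:Z)%R)%:Z = i /\
  j + (absz (i + N%:Z)%R)%:Z = i + (j + N%:Z) by lia.
by rewrite /translate -e2 -wji ?e1 //; lia.
Qed.

(** * Types eventually equal to 1: failure of minimality *)

Definition without_LD : set (int -> letter) := [set y | forall i, y i <> LD].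

Lemma without_LD_limit_closed : limit_closed without_LD.
Proof. by move=> y hy i; have [w noD wy] := hy `|i|%N; rewrite -wy. Qed.

Lemma without_LD_translate : translation_invariant without_LD.
Proof. by move=> c y noD i; apply: noD. Qed.

Section Type1.
Variable tau : nat -> bool.
Hypothesis tau1 : forall n, tau n.

(** Substituting [n] times into an alternating seed with property [P] preserves [P]. *)
Lemma type1_nonempty (P : set (int -> letter)) n :
  (forall y b z, desubst true y b z -> P z -> P y) ->
  alternate `&` P !=set0 -> P `&` lifted tau n alternate !=set0.
Proof.
move=> hP [u [altu Pu]].
elim: n tau tau1 => [|n IH] s s1; first by exists u.
have [|z [Pz zl]] := IH (tail s 1); first by move=> k; apply: s1.
have [b [y h]] := desubst_exists (s 0%N) (lifted_alternate zl).
exists y; split; last by exists b, z.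
by apply: hP Pz; rewrite -(s1 0%N); apply: h.
Qed.

Lemma type1_without_LD : without_LD `&` Y tau !=set0.
Proof.
apply: Y_nonempty without_LD_limit_closed _ => n.
apply: type1_nonempty => [y b z h noD i|].
  have [j [k [kj _ ->]]] := desubst_at h i.
  by move: (noD j) kj; case: (z j); case: k => [|[|[|k]]].
exists alternating_AB; split; first exact: alternating_AB_alternate.
by move=> i; rewrite /alternating_AB; case: odd.
Qed.

Lemma type1_with_LD : exists2 y, Y tau y & ~ without_LD y.
Proof.
(* Containing [LD] somewhere is not a closed condition; a translation pins the occurrence at 0,
   where it survives limits. *)
pose F : set (int -> letter) := [set y | y 0 = LD].
have [| |y [y0 Yy]] := @Y_nonempty tau F; last by exists y => // /(_ 0).
  by move=> y hy; have [w w0 wy] := hy 0%N; rewrite /F /= -wy.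
move=> n; pose P : set (int -> letter) := [set y | exists i, y i = LD].
have [| |y [[i yi] hy]] := @type1_nonempty P n; last first.
- exists (translate i y); split; first by rewrite /F /translate /= add0r.
  exact: (lifted_translate alternate_translate).
(* The seed alternates C and D, with D at odd positions. *)
- exists (fun i => mk_letter (odd `|i|%N) true); split.
    move=> i; rewrite !sym3_mk; lia.
  by exists 1.
(* Offset 1 is the middle of CDC, the image of D. *)
move=> y b z h [i zi]; have [|j yj] := desubst_occurs (k := 1) (i := i) h.
  by rewrite zi.
by exists j; rewrite yj zi.
Qed.

End Type1.

Lemma lifted_inhabited s n Q y : lifted s n Q y -> Q !=set0.
Proof.
by elim: n s y => [s y Qy|n IH s y [b [z [_ /IH//]]]]; exists y.
Qed.

Lemma Y_not_minimal (tau : nat -> bool) N : (forall n, (N <= n)%N -> tau n) ->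
  ~ minimal_subshift (Y tau : set (fullshift letter)).
Proof.
move=> tau1 [_]; apply.
have tail1 n : tail tau N n by apply: tau1; rewrite leq_addl.
pose Q := without_LD `&` Y (tail tau N).
have [q Qq] : Q !=set0 := type1_without_LD tail1.
have altY s : Y s `<=` alternate by move=> y /(_ 0%N).
exists (lifted tau N Q : set (fullshift letter)).
  apply: subshiftP.
  - apply: lifted_nonempty; last by exists q.
    by apply: subset_trans (altY (tail tau N)); apply: subIsetr.
  - apply: lifted_limit_closed => y hy; split.
      by apply: without_LD_limit_closed => k; have [w [? _] ?] := hy k; exists w.
    by apply: Y_limit_closed => k; have [w [_ ?] ?] := hy k; exists w.
  - apply: lifted_translate => c y [noD Yy].
    by split; [apply: without_LD_translate|apply: Y_translate].
split.
  by rewrite [X in _ `<=` X](Y_lifted tau N); apply: lifted_sub; apply: subIsetr.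
(* Lifting a sequence that contains [LD] gives an element of [Y tau]; were it in the smaller
   subshift, its unique [N]-th desubstitution would both avoid and contain [LD]. *)
move=> YW; have [z Yz zD] := type1_with_LD tail1.
have [||y hy] := @lifted_nonempty tau N (Y (tail tau N) `&` ~` without_LD).
- by apply: subset_trans (altY (tail tau N)); apply: subIsetl.
- by exists z.
have /YW yW : Y tau y.
  by rewrite (Y_lifted tau N); apply: lifted_sub hy; apply: subIsetl.
by have [u [[noD _] [_]]] := lifted_inhabited (liftedI yW hy).
Qed.

Theorem theorem4p3 (tau : nat -> 'I_2) :
  subshift (Ytau tau) /\
  (minimal_subshift (Ytau tau) <-> infinite_set [set n | tau n = ord0]).
Proof.
rewrite Ytau_eq; split; first exact: Y_subshift.
split=> [min /finite_seqP[s sE]|inf0].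
  (* Beyond the largest of the finitely many indices of type 0, all types are 1. *)
  apply: (@Y_not_minimal _ (\max_(n <- s) n)%N.+1 _ min) => n /= sn.
  apply/eqP => tn; have ns : [set` s] n by rewrite -sE.
  by have := @leq_bigmax_seq _ s xpredT id n ns isT; rewrite leqNgt sn.
apply: Y_minimal => m; apply: contrapT => nex; apply: inf0.
apply: sub_finite_set (finite_II m) => n tn; rewrite /= ltnNge.
by apply/negP => mn; apply: nex; exists n => //; rewrite /nonzero_type tn eqxx.
Qed.
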